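(* Let $G$ be the Petersen graph, let $\sigma$ be the normal $5$-edge-coloring of $G$ (which is unique up to permutation of colors), and let $C$ be a cycle of length $5$ in $G$. Let $\tilde{G}\in\mathcal{G}_{C}(\mathcal{A},\mathcal{B})$ be the superposition in which every vertex of $C$ is superposed by $A$. Then there exists precisely one normal $5$-edge-coloring $\tilde{\sigma}_{\mathrm{ext}}$ of the submultipole $M_{\mathrm{ext}}$ of $\tilde{G}$ such that $\tilde{\sigma}_{\mathrm{ext}}|_{M_{\mathrm{int}}}=\sigma|_{M_{\mathrm{int}}}$. Also, for the submultipole $M_{123}$ of $\tilde{G}$ induced by $V(\mathcal{B}_{1})\cup V(\mathcal{A}_{2})\cup V(\mathcal{B}_{2})\cup V(\mathcal{A}_{3})\cup V(\mathcal{B}_{3})$, there exists no normal $5$-edge-coloring $\tilde{\sigma}_{1}$ of $M_{123}$ which is compatible with $\tilde{\sigma}_{\mathrm{ext}}$.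
   Context: The graph $\tilde G$: write $C=u_0u_1u_2u_3u_4u_0$, indices modulo $5$, and let $v_i$ be the neighbor of $u_i$ in $G$ outside $C$. The graph $\tilde G$ (all vertices of $C$ superposed by $A$, all edges of $C$ superposed by the superedge $B$, obtained from the Petersen graph by removing two non-adjacent vertices) is obtained from $G$ by: deleting the edges $u_iu_{i+1}$ of $C$; adding, for each $i\in\{0,\dots,4\}$, eight new vertices $a_i,b_i,c_i,d_i,e_i,f_i,g_i,h_i$ and the nine edges $a_ib_i,\ b_ie_i,\ b_if_i,\ c_id_i,\ c_if_i,\ d_ie_i,\ e_ig_i,\ f_ih_i,\ g_ih_i$; and adding, for each $i$, the edges $u_ia_i$, $a_iu_{i+1}$, $d_{i-1}c_i$ and $h_{i-1}g_i$. Here $V(\mathcal{B}_i)=\{a_i,b_i,c_i,d_i,e_i,f_i,g_i,h_i\}$ and $V(\mathcal{A}_i)=\{u_i\}$. Multipoles: a (cubic) multipole consists of vertices, edges and semiedges (half-edges), each vertex being incident to exactly three edges or semiedges. For a set $T$ of vertices of a cubic graph, the submultipole induced by $T$ has vertex set $T$, edge set all edges with both ends in $T$, and as semiedges the halves of all edges with exactly one end in $T$. $M_{\mathrm{int}}$ is the submultipole of $\tilde G$ induced by $V(G)\setminus V(C)$ (it is also the submultipole of $G$ induced by this set, so $\sigma$ can be restricted to it), and $M_{\mathrm{ext}}$ is the submultipole of $\tilde G$ induced by $V(G)\cup\{a_0,\dots,a_4\}$. Colorings: a (proper) $5$-edge-coloring of a multipole (or graph) assigns to each edge and semiedge a color in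 $\{1,\dots,5\}$ so that edges and semiedges incident to the same vertex have distinct colors. For a vertex $v$, $\sigma(v)$ is the set of the three colors at $v$. An edge $uv$ (both ends being vertices of the multipole) is normal if $|\sigma(u)\cup\sigma(v)|\in\{3,5\}$; the coloring is normal if every edge is normal (no condition is imposed on semiedges beyond properness). The restriction of a coloring to a submultipole assigns to each edge or semiedge of the submultipole its color, a semiedge that is a half of an edge $e$ receiving the color of $e$. Union and compatibility: for submultipoles $M',M''$ of a multipole $M$, the union $M'\cup M''$ has as vertices the union of the vertex sets; as edges, the edges of $M$ that are edges of $M'$ or of $M''$ or that have one half as a semiedge of $M'$ and the other half as a semiedge of $M''$; and as semiedges, the semiedges of $M'$ or $M''$ that are not halves of an edge of the union. Normal colorings $\sigma'$ of $M'$ and $\sigma''$ of $M''$ are compatible if there is a normal coloring of $M'\cup M''$ (with the same set of colors $\{1,\dots,5\}$) whose restriction to $M'$ is $\sigma'$ and whose restriction to $M''$ is $\sigma''$. *)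

(* Defs.v *)
From HB Require Import structures.
From mathcomp Require Import all_boot zmodp.

Set Implicit Arguments.
Unset Strict Implicit.
Unset Printing Implicit Defensive.

(* The Petersen graph, drawn as an outer pentagon (inl), an inner pentagram   *)
(* (inr) and five spokes.                                                     *)
Definition petersen_vertex : finType := ('I_5 + 'I_5)%type.

Definition petersen : rel petersen_vertex := fun x y =>
  match x, y with
  | inl i, inl j => (j == ordS i) || (i == ordS j)
  | inr i, inr j => (j == ordS (ordS i)) || (i == ordS (ordS j))
  | inl i, inr j | inr i, inl j => i == j
  end.

Definition five_cycle (V : finType) (e : rel V) (u : 'I_5 -> V) : Prop :=
  injective u /\ forall i, e (u i) (u (ordS i)).

Definition cycle_vertices (V : finType) (u : 'I_5 -> V) : {set V} :=
  [set u i | i : 'I_5].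

Definition cycle_edge (V : finType) (u : 'I_5 -> V) : rel V := fun x y =>
  [exists i, [set x; y] == [set u i; u (ordS i)]].

(* Inside a fixed ambient simple graph, an edge xy is the set [set x; y], and *)
(* the half of the edge xy attached to x is the pair (x, y).  An element of a *)
(* multipole is one of its edges (inl) or one of its semiedges (inr).  The    *)
(* record does not impose cubicity: the multipoles colored below are           *)
(* submultipoles of cubic graphs, see induced_cubic, superposition_cubic and  *)
(* M_ext_M_123_cubic.                                                         *)
Definition element (V : finType) : finType := ({set V} + V * V)%type.

Record multipole (V : finType) := Multipole {
  mvertices : {set V};
  medges : {set {set V}};
  msemiedges : {set V * V}
}.

Definition edge_of (V : finType) (h : V * V) : {set V} := [set h.1; h.2].

Definition in_multipole (V : finType) (M : multipole V) (z : element V) : bool :=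
  match z with
  | inl E => E \in medges M
  | inr h => h \in msemiedges M
  end.

Definition incident (V : finType) (v : V) (z : element V) : bool :=
  match z with
  | inl E => v \in E
  | inr h => v == h.1
  end.

Definition cubic_multipole (V : finType) (M : multipole V) : Prop :=
  forall v, v \in mvertices M ->
    #|[set z | in_multipole M z & incident v z]| = 3.

Definition graph_edges (V : finType) (e : rel V) : {set {set V}} :=
  [set edge_of h | h : V * V & e h.1 h.2].

Definition induced (V : finType) (e : rel V) (T : {set V}) : multipole V :=
  {| mvertices := T;
     medges := [set E in graph_edges e | E \subset T];
     msemiedges := [set h | [&& e h.1 h.2, h.1 \in T & h.2 \notin T]] |}.

(* The graph e itself, seen as a multipole (without semiedges).               *)
Definition whole (V : finType) (e : rel V) : multipole V := induced e [set: V].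

(* Union of two submultipoles of the ambient graph e.                         *)
Definition union_edges (V : finType) (e : rel V) (M1 M2 : multipole V) :
    {set {set V}} :=
  [set E in graph_edges e |
    [|| E \in medges M1, E \in medges M2
      | [exists x, exists y, [&& E == [set x; y],
           (x, y) \in msemiedges M1 & (y, x) \in msemiedges M2]]]].

Definition munion (V : finType) (e : rel V) (M1 M2 : multipole V) :
    multipole V :=
  {| mvertices := mvertices M1 :|: mvertices M2;
     medges := union_edges e M1 M2;
     msemiedges := [set h in msemiedges M1 :|: msemiedges M2 |
                      edge_of h \notin union_edges e M1 M2] |}.

(* A coloring of a multipole is a partial function, required below to be      *)
(* defined exactly on the edges and semiedges of the multipole; thus equality *)
(* of colorings is Leibniz equality.                                          *)
Definition coloring (V : finType) : finType := {ffun element V -> option 'I_5}.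

Definition colors_at (V : finType) (s : coloring V) (v : V) : {set 'I_5} :=
  [set c | [exists z, incident v z && (s z == Some c)]].

Definition proper_coloring (V : finType) (M : multipole V) (s : coloring V) :
    Prop :=
  (forall z, (s z != None) = in_multipole M z) /\
  (forall v z1 z2, v \in mvertices M ->
     in_multipole M z1 -> in_multipole M z2 ->
     incident v z1 -> incident v z2 -> z1 <> z2 -> s z1 <> s z2).

Definition normal_coloring (V : finType) (M : multipole V) (s : coloring V) :
    Prop :=
  proper_coloring M s /\
  (forall x y, [set x; y] \in medges M ->
     #|colors_at s x :|: colors_at s y| \in [:: 3; 5]).

(* Restriction to a submultipole M: a semiedge of M either is a semiedge of   *)
(* the larger multipole, or inherits the color of the edge it is a half of.   *)
Definition restrict (V : finType) (M : multipole V) (s : coloring V) :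
    coloring V :=
  [ffun z => if in_multipole M z then
               match z with
               | inl _ => s z
               | inr h => if s z is Some c then Some c else s (inl (edge_of h))
               end
             else None].

Definition compatible (V : finType) (e : rel V) (M1 M2 : multipole V)
    (s1 s2 : coloring V) : Prop :=
  exists t : coloring V,
    [/\ normal_coloring (munion e M1 M2) t, restrict M1 t = s1
      & restrict M2 t = s2].

(* The eight new vertices a_i, ..., h_i of a superedge.                       *)
Inductive letter := La | Lb | Lc | Ld | Le | Lf | Lg | Lh.

Definition nat_of_letter (p : letter) : nat :=
  match p with
  | La => 0 | Lb => 1 | Lc => 2 | Ld => 3 | Le => 4 | Lf => 5 | Lg => 6 | Lh => 7
  end.
Definition ord_of_letter (p : letter) : 'I_8 := inZp (nat_of_letter p).
Definition letter_of_ord (i : 'I_8) : letter :=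
  nth La [:: La; Lb; Lc; Ld; Le; Lf; Lg; Lh] i.
Lemma ord_of_letterK : cancel ord_of_letter letter_of_ord.
Proof. by case. Qed.
HB.instance Definition _ := Countable.copy letter (can_type ord_of_letterK).
HB.instance Definition _ : isFinite letter := CanIsFinite ord_of_letterK.

Definition superedge_links : seq (letter * letter) :=
  [:: (La, Lb); (Lb, Le); (Lb, Lf); (Lc, Ld); (Lc, Lf); (Ld, Le); (Le, Lg);
      (Lf, Lh); (Lg, Lh)].

(* Vertices of the superposition: inl x is the old vertex x, and inr (i, p)   *)
(* is the new vertex p_i.                                                     *)
Definition sup_vertex (V : finType) : finType := (V + 'I_5 * letter)%type.

(* Each edge of the superposition in one (arbitrary) direction.               *)
Definition sup_arc (V : finType) (e : rel V) (u : 'I_5 -> V) :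
    rel (sup_vertex V) := fun x y =>
  match x, y with
  | inl v, inl w => e v w && ~~ cycle_edge u v w
  | inl v, inr (i, p) => (p == La) && ((v == u i) || (v == u (ordS i)))
  | inr (i, p), inr (j, q) =>
      (i == j) && ((p, q) \in superedge_links)
      || (j == ordS i) && ((p, q) \in [:: (Ld, Lc); (Lh, Lg)])
  | inr _, inl _ => false
  end.

Definition superposition (V : finType) (e : rel V) (u : 'I_5 -> V) :
    rel (sup_vertex V) := fun x y => sup_arc e u x y || sup_arc e u y x.

Definition supervertex (V : finType) (u : 'I_5 -> V) (i : 'I_5) :
    {set sup_vertex V} := [set inl (u i)].

Definition superedge (V : finType) (i : 'I_5) : {set sup_vertex V} :=
  [set inr (i, p) | p : letter].

Definition old_vertices (V : finType) : {set sup_vertex V} :=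
  [set inl x | x : V].

Definition M_ext (V : finType) (e : rel V) (u : 'I_5 -> V) :
    multipole (sup_vertex V) :=
  induced (superposition e u)
    (old_vertices V :|: [set inr (i, La) | i : 'I_5]).

(* M_int, as a submultipole of the superposition and of the original graph.   *)
Definition M_int (V : finType) (e : rel V) (u : 'I_5 -> V) :
    multipole (sup_vertex V) :=
  induced (superposition e u) [set inl x | x in ~: cycle_vertices u].

Definition M_int_old (V : finType) (e : rel V) (u : 'I_5 -> V) : multipole V :=
  induced e (~: cycle_vertices u).

Definition M_123 (V : finType) (e : rel V) (u : 'I_5 -> V) :
    multipole (sup_vertex V) :=
  induced (superposition e u)
    (superedge V (inZp 1) :|: supervertex u (inZp 2) :|: superedge V (inZp 2)
     :|: supervertex u (inZp 3) :|: superedge V (inZp 3)).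

(* Identification of the elements of M_int_old with those of M_int, and the   *)
(* corresponding transport of colorings.                                      *)
Definition old_element (V : finType) (z : element V) :
    element (sup_vertex V) :=
  match z with
  | inl E => inl [set inl x | x in E]
  | inr (x, y) => inr (inl x, inl y)
  end.

Definition on_old (V : finType) (s : coloring (sup_vertex V)) : coloring V :=
  [ffun z => s (old_element z)].

Lemma set2_inj (T : finType) (x y z : T) : [set x; y] = [set x; z] -> y = z.
Proof.
move=> /setP E; have := E y; have := E z; rewrite !inE !eqxx !orbT.
case/orP=> /eqP->; last by [].
by move/esym; rewrite orbb => /eqP.
Qed.

Lemma induced_cubic (V : finType) (e : rel V) (T : {set V}) :
  symmetric e -> (forall v, #|[set w | e v w]| = 3) ->
  cubic_multipole (induced e T).
Proof.
move=> symE cub v /= vT.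
pose f w : element V := if w \in T then inl [set v; w] else inr (v, w).
have injf : injective f.
  move=> w w'; rewrite /f; case: ifP; case: ifP => // _ _ [] //.
  exact: set2_inj.
rewrite -(cub v) -(card_imset _ injf); apply: eq_card => z; rewrite inE.
apply/idP/imsetP.
  case: z => [E | [x y]] /=; rewrite !inE /=.
    move=> /andP[/andP[/imsetP[[x y]]]]; rewrite inE /= => exy -> sub.
    have [xT yT] : x \in T /\ y \in T.
      by split; apply: (subsetP sub); rewrite !inE eqxx ?orbT.
    rewrite /edge_of /= !inE => /orP[] /eqP vE.
      by exists y; rewrite ?inE ?vE // /f yT vE.
    by exists x; rewrite ?inE ?vE 1?symE // /f xT vE setUC.
  move=> /andP[/and3P[exy xT yT] /eqP vE]; exists y; rewrite ?inE ?vE //.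
  by rewrite /f (negbTE yT) vE.
case=> w; rewrite inE => evw ->; rewrite /f; case: ifP => wT /=.
  rewrite !inE eqxx andbT; apply/andP; split.
    by apply/imsetP; exists (v, w); rewrite ?inE.
  by apply/subsetP => a; rewrite !inE => /orP[] /eqP->.
by rewrite inE /= evw vT wT eqxx.
Qed.

Lemma petersen_sym : symmetric petersen.
Proof. by case=> i [] j; rewrite /petersen; [rewrite orbC|rewrite eq_sym|rewrite eq_sym|rewrite orbC]. Qed.

Lemma card3 (T : finType) (x y z : T) (P : pred T) :
  P =1 (fun w => [|| w == x, w == y | w == z]) ->
  [&& x != y, x != z & y != z] -> #|[set w | P w]| = 3.
Proof.
move=> eP /and3P[xy xz yz].
have -> : [set w | P w] = z |: [set x; y].
  by apply/setP=> w; rewrite !inE eP; case: (w == x); case: (w == y); case: (w == z).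
by rewrite cardsU1 cards2 !inE negb_or ![z == _]eq_sym xy xz yz.
Qed.

Lemma ordS_neq (i : 'I_5) :
  (i == ordS i = false) * (ordS i == ord_pred i = false)
  * (i == ord_pred i = false).
Proof. by case: i => -[|[|[|[|[|]]]]] h; do !split. Qed.

Lemma petersen_cubic v : #|[set w | petersen v w]| = 3.
Proof.
have S i j : (i == ordS j) = (j == ord_pred i :> 'I_5).
  by rewrite [RHS]eq_sym -(inj_eq (@ordS_inj _) (ord_pred i)) ord_predK.
case: v => i.
  apply: (@card3 _ (inl (ordS i)) (inl (ord_pred i)) (inr i)); last first.
    by rewrite /eq_op /= ordS_neq.
  case=> j; rewrite /petersen ![_ == inr i]/eq_op ![_ == inl _]/eq_op /= ?orbF.
    by rewrite [i == ordS j]S.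
  by rewrite eq_sym.
apply: (@card3 _ (inr (ordS (ordS i))) (inr (ord_pred (ord_pred i))) (inl i)); last first.
  by rewrite /eq_op /=; case: i => -[|[|[|[|[|]]]]].
case=> j; rewrite /petersen ![_ == inr _]/eq_op ![_ == inl _]/eq_op /= ?orbF.
  by rewrite eq_sym.
by rewrite [i == ordS _]S [ordS j == _]eq_sym [_ == ordS j]S.
Qed.

Lemma superposition_sym (V : finType) (e : rel V) (u : 'I_5 -> V) :
  symmetric (superposition e u).
Proof. by move=> x y; rewrite /superposition orbC. Qed.

Lemma superposition_cubic (V : finType) (e : rel V) (u : 'I_5 -> V) :
  symmetric e -> (forall v, #|[set w | e v w]| = 3) -> five_cycle e u ->
  forall x, #|[set y | superposition e u x y]| = 3.
Proof.
move=> symE cub cyc x.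
have [injU cyE] := cyc.
have S (i j : 'I_5) : (i == ordS j) = (j == ord_pred i).
  by rewrite [RHS]eq_sym -(inj_eq (@ordS_inj _) (ord_pred i)) ord_predK.
have cS v w : cycle_edge u v w = cycle_edge u w v.
  by rewrite /cycle_edge; apply: eq_existsb => i; rewrite (setUC [set v]).
case: x => [x|[i p]]; last first.
  pose n (j : 'I_5) (q : letter) : sup_vertex V := inr (j, q).
  pose o (j : 'I_5) : sup_vertex V := inl (u j).
  pose s := match p with
   | La => (o i, o (ordS i), n i Lb) | Lb => (n i La, n i Le, n i Lf)
   | Lc => (n i Ld, n i Lf, n (ord_pred i) Ld)
   | Ld => (n i Lc, n i Le, n (ordS i) Lc)
   | Le => (n i Lb, n i Ld, n i Lg)
   | Lf => (n i Lb, n i Lc, n i Lh)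
   | Lg => (n i Le, n i Lh, n (ord_pred i) Lh)
   | Lh => (n i Lf, n i Lg, n (ordS i) Lg) end.
  have P (a b : 'I_5 * letter) : (inr a == inr b :> sup_vertex V) = (a.1 == b.1) && (a.2 == b.2).
    by case: a b => [? ?] [? ?].
  have Q a b : (inl a == inl b :> sup_vertex V) = (a == b) by [].
  have R a b : (inl a == inr b :> sup_vertex V) = false by [].
  have R' a b : (inr a == inl b :> sup_vertex V) = false by [].
  pose PQ := (P, Q, R, R').
  apply: (@card3 _ s.1.1 s.1.2 s.2); last first.
    rewrite /s /n /o; clear s n o; case: p; rewrite /= ?PQ /= ?(inj_eq injU) ?ordS_neq ?andbF //.
  case=> [y|[j q]]; rewrite /superposition /s /n /o; clear s n o; case: p;
   rewrite /= ?PQ ?orbF //=; case: q; rewrite /= ?PQ ?inE /= ?andbT ?andbF ?orbF //;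
   rewrite ?[j == ordS i]S ?[i == ordS j]S ?[i == j]eq_sym ?[i == ord_pred j]eq_sym ?orbb //;
   by rewrite /= orbC.
case: (boolP (x \in cycle_vertices u)) => [/imsetP[j _ ->{x}] | xC].
  pose N := [set w | e (u j) w] :\: [set u (ordS j); u (ord_pred j)].
  have ne : u (ordS j) != u (ord_pred j) by rewrite (inj_eq injU) ordS_neq.
  have e2 : e (u j) (u (ord_pred j)) by rewrite symE -{2}(ord_predK j).
  have: #|N| = 1.
    have := cub (u j); rewrite -(cardsID [set u (ordS j); u (ord_pred j)]).
    rewrite (setIidPr _) ?cards2 ?ne; first by case.
    by apply/subsetP=> w; rewrite !inE => /orP[] /eqP->.
  move/eqP/cards1P=> [w Nw].
  have Hw v : (v == w) = [&& v != u (ordS j), v != u (ord_pred j) & e (u j) v].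
    by rewrite -in_set1 -Nw !inE negb_or andbA.
  apply: (@card3 _ (inl w) (inr (j, La)) (inr (ord_pred j, La))); last first.
    by rewrite /= (inj_eq (@inr_inj _ _)) xpair_eqE eqxx andbT ordS_neq.
  case=> [v|[i p]]; rewrite /superposition /=; last first.
    rewrite !(inj_eq (@inr_inj _ _)) !xpair_eqE !(inj_eq injU) S orbF.
    by rewrite ![i == _]eq_sym ![_ == i]eq_sym; case: (p == La); rewrite ?andbT ?andbF // -S [i == j]eq_sym orbC S orbC.
  rewrite !(inj_eq (@inl_inj _ _)) !orbF Hw symE cS orbb symE.
  suff -> : cycle_edge u v (u j) = (v == u (ordS j)) || (v == u (ord_pred j)).
    by rewrite negb_or andbC -andbA.
  apply/existsP/orP => [[i]|[] /eqP->].
  - move/eqP=> E; have: u j \in [set u i; u (ordS i)] by rewrite -E !inE eqxx orbT.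
    rewrite !inE !(inj_eq injU) => /orP[/eqP ji|/eqP ji].
      by left; apply/eqP/(@set2_inj _ (u j)); rewrite setUC E ji.
    by right; apply/eqP/(@set2_inj _ (u j)); rewrite setUC E ji ordSK setUC.
  - by exists j; rewrite setUC.
  by exists (ord_pred j); rewrite ord_predK.
transitivity #|[set (inl w : sup_vertex V) | w in [set w | e x w]]|; last first.
  by rewrite card_imset //; exact: inl_inj.
have nc y : cycle_edge u x y = false.
  apply/existsP=> -[i /eqP E]; have: x \in [set x; y] by rewrite !inE eqxx.
  by rewrite E !inE => /orP[] /eqP Ex; case/imsetP: xC; eexists; rewrite ?Ex.
have nu i : (x == u i) = false.
  by apply/eqP=> E; case/imsetP: xC; exists i.
apply: eq_card => -[v|[i p]]; rewrite !inE /superposition /=.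
  by rewrite (mem_imset _ _ (@inl_inj _ _)) inE nc cS nc !andbT (symE v) orbb.
by rewrite !nu andbF; apply/esym/imsetP=> -[].
Qed.

(* M_int_old and M_int are the same multipole, through old_element.           *)
Lemma in_M_int (V : finType) (e : rel V) (u : 'I_5 -> V) z :
  symmetric e ->
  (in_multipole (M_int e u) z <->
   exists2 z0, in_multipole (M_int_old e u) z0 & z = old_element z0).
Proof.
move=> symE.
have inlI : injective (fun x : V => inl x : sup_vertex V) by move=> ? ? [].
have nC x y : x \notin cycle_vertices u -> (superposition e u (inl x) (inl y)) = e x y.
  move=> xC; have nc v w : v = x \/ w = x -> cycle_edge u v w = false.
    move=> vw; apply/existsP=> -[i /eqP E]; have: x \in [set v; w].
      by case: vw => ->; rewrite !inE eqxx ?orbT.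
    by rewrite E !inE => /orP[] /eqP Ex; case/imsetP: xC; eexists; rewrite ?Ex.
  by rewrite /superposition /= !nc; [rewrite !andbT symE orbb|right|left].
split.
  case: z => [E|[x y]] /=; rewrite !inE /=.
    case/andP=> /imsetP[[x y]]; rewrite inE /edge_of /= => exy -> /subsetP sub.
    have /imsetP[x' x'C xE] : x \in [set (inl x : sup_vertex V) | x in ~: cycle_vertices u] by rewrite sub // !inE eqxx.
    have /imsetP[y' y'C yE] : y \in [set (inl x : sup_vertex V) | x in ~: cycle_vertices u] by rewrite sub // !inE eqxx orbT.
    subst x y; rewrite inE in x'C; rewrite inE in y'C.
    exists (inl [set x'; y']); last by rewrite /= imsetU1 imset_set1.
    rewrite /= !inE; apply/andP; split.
      by apply/imsetP; exists (x', y'); rewrite // inE /= -(nC _ _ x'C).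
    by apply/subsetP=> v; rewrite !inE => /orP[] /eqP->.
  case/and3P=> exy /imsetP[x' x'C xE] yT; subst x; rewrite inE in x'C.
  case: y => [y|[i p]] in exy yT *; last first.
    move: exy; rewrite /superposition /= orbF => /andP[_ /orP[] /eqP xE];
    by case/imsetP: x'C; eexists; rewrite ?xE.
  exists (inr (x', y)) => //; rewrite /= !inE /= -(nC _ _ x'C) exy x'C /=.
  by move: yT; rewrite (mem_imset _ _ inlI) !inE.
case=> -[E|[x y]] /= + ->; rewrite !inE /=.
  case/andP=> /imsetP[[x y]]; rewrite inE /edge_of /= => exy -> /subsetP sub.
  have xC : x \notin cycle_vertices u by rewrite -in_setC sub // !inE eqxx.
  rewrite inE; apply/andP; split; last by apply/imsetS/subsetP.
  apply/imsetP; exists (inl x, inl y); first by rewrite inE /= nC.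
  by rewrite /= imsetU1 imset_set1.
case/and3P=> exy xC yC.
by rewrite inE /= nC // exy !(mem_imset _ _ inlI) !inE xC yC.
Qed.

Lemma M_ext_M_123_cubic (u : 'I_5 -> petersen_vertex) :
  five_cycle petersen u ->
  cubic_multipole (M_ext petersen u) /\ cubic_multipole (M_123 petersen u).
Proof.
move=> cyc.
have cub := superposition_cubic petersen_sym petersen_cubic cyc.
by split; apply: induced_cubic => //; exact: superposition_sym.
Qed.

(* Main.v *)
Require Import Defs.
From mathcomp Require Import all_boot zmodp.

Set Implicit Arguments.
Unset Strict Implicit.
Unset Printing Implicit Defensive.

(** Write x_i for the color of u_i u_(i+1) in the given coloring of the Petersen
    graph.  The coloring is rigid: the x_i are five distinct colors, the spoke
    u_i v_i has color x_(i+2), and v_i v_(i+2) has color x_(i+3)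
    ([petersen_coloring]).  Since every pentagon is carried to any other one by
    an automorphism ([petersen_embedding]), one may rename vertices and colors
    so that C is the outer pentagon and x_i = i; colors are then counted
    modulo 5.

    Extension.  At v_i one sees i+1, i+2, i+3, with i+2 on the spoke, so
    normality of the spoke leaves for the two other edges at u_i either the
    pair {i-1, i} or the pair {i+1, i+3}.  Let (p_i, q_i) be the colors of
    (u_i a_i, u_i a_(i-1)).  Normality along the path u_i a_i u_(i+1) allows
    only three successions ([extension_step]): (i, i-1) at u_i must be followed
    by its mirror image (first color i, second color i+1) at u_(i+1), the mirror
    image by the unmirrored pair, and (i+1, i+3) by the analogous
    (i+2, i+4).  The first two alternate, which an odd cycle forbids, so
    p_i = i+1 and q_i = i+3 for all i, and then a_i b_i has color i
    ([extension_forced]).  This assignment is normal ([ext_color_normal]), which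
    gives existence and uniqueness.

    Obstruction.  The superedges B_i and B_(i+1) are linked by the two edges
    d_i c_(i+1) and h_i g_(i+1).  The colors at a_i and a_(i+1) being known, the
    two linking edges must have equal colors as soon as both superedges are
    normally colored ([consecutive_superedges]); but in a single superedge the
    two edges going to the left and the two edges going to the right cannot
    both form monochromatic pairs ([superedge_not_both_sides]).  The superedge
    B_2, linked to B_1 and to B_3, would need exactly that
    ([no_three_superedges]).

    The finite case analyses are backtracking searches evaluated by the kernel.
    To feed them, a coloring of a multipole is replaced by a function of two
    adjacent vertices, the color of the half-edge from the first towards the
    second ([hue]); normality becomes [normal_on], which is stable under graph
    isomorphisms and permutations of the colors ([normal_on_transport]). *)


(** * Colorings as functions of half-edges *)

Section HalfEdges.
Variables (V : finType) (e : rel V).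
Hypothesis symE : symmetric e.
Implicit Types (T : {set V}) (s : coloring V) (k : V -> V -> 'I_5).

(** [k x y] is thought of as the color of the half-edge at [x] towards [y], for
    adjacent [x] and [y]. *)
Definition palette k x : {set 'I_5} := [set k x y | y in e x].

Definition normal_on T k :=
  [/\ {in T &, forall x y, e x y -> k x y = k y x},
      {in T, forall x, {in e x &, injective (k x)}} &
      {in T &, forall x y, e x y -> #|palette k x :|: palette k y| \in [:: 3; 5]}].

Definition supported T s := forall z, (s z != None) = in_multipole (induced e T) z.

(** In the submultipole induced by [T], the element reached from [x] towards its
    neighbor [y]: an edge, or a semiedge when [y] lies outside [T]. *)
Definition arm T x y : element V :=
  if y \in T then inl [set x; y] else inr (x, y).

Lemma arm_in T x y : x \in T -> e x y -> in_multipole (induced e T) (arm T x y).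
Proof.
move=> xT exy; rewrite /arm; case: ifP => yT /=; rewrite !inE /= ?exy ?xT ?yT //.
rewrite subUset !sub1set xT yT !andbT.
by apply/imsetP; exists (x, y); rewrite ?inE.
Qed.

Lemma arm_incident T x y : incident x (arm T x y).
Proof. by rewrite /arm; case: ifP => _ /=; rewrite ?inE eqxx. Qed.

Lemma arm_inj T x : injective (arm T x).
Proof. by move=> y z; rewrite /arm; do 2!case: ifP => // _; case=> // /set2_inj. Qed.

Lemma arm_sym T : {in T &, forall x y, arm T x y = arm T y x}.
Proof. by move=> x y xT yT; rewrite /arm xT yT setUC. Qed.

Lemma incident_arm T z x : in_multipole (induced e T) z -> incident x z ->
  [/\ x \in T & exists2 y, e x y & z = arm T x y].
Proof.
case: z => [E|[a b]] /=; rewrite !inE /=.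
  case/andP=> /imsetP[[a b]]; rewrite inE /edge_of /= => eab ->.
  rewrite subUset !sub1set => /andP[aT bT]; rewrite !inE => /orP[] /eqP->.
    by split=> //; exists b; rewrite // /arm bT.
  by split=> //; exists a; rewrite 1?symE // /arm aT setUC.
case/and3P=> eab aT /negbTE bT /eqP->; split=> //.
by exists b; rewrite // /arm bT.
Qed.

(** Looking at the semiedge first makes the value insensitive to [restrict],
    which turns edges into semiedges; the default [ord0] is never reached on
    the arms of a supported coloring. *)
Definition arm_color_opt s x y : option 'I_5 :=
  if s (inr (x, y)) is Some c then Some c else s (inl [set x; y]).

Definition hue s x y : 'I_5 := odflt ord0 (arm_color_opt s x y).

Lemma arm_color T s x y : supported T s -> x \in T -> e x y ->
  s (arm T x y) = arm_color_opt s x y.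
Proof.
move=> supp xT exy; have := supp (arm T x y); rewrite arm_in // /arm_color_opt /arm.
case: ifP => yT; last by case: (s _).
by move=> _; have := supp (inr (x, y)); rewrite /= inE /= yT !andbF; case: (s _).
Qed.

Lemma arm_hue T s x y : supported T s -> x \in T -> e x y ->
  s (arm T x y) = Some (hue s x y).
Proof.
move=> supp xT exy; have := supp (arm T x y); rewrite arm_in // /hue.
by rewrite -(arm_color supp xT exy); case: (s _).
Qed.

(** The elements incident to a vertex [x] of the multipole are exactly its arms,
    one for each neighbor of [x]; hence properness and normality only speak of
    the values of [k]. *)
Lemma normal_coloringP T s k : supported T s ->
    {in T, forall x y, e x y -> s (arm T x y) = Some (k x y)} ->
  normal_coloring (induced e T) s <-> normal_on T k.
Proof.
move=> supp sk.
have pal x : x \in T -> colors_at s x = palette k x.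
  move=> xT; apply/setP=> c; rewrite inE; apply/existsP/imsetP.
    case=> z /andP[xz /eqP sz].
    have /incident_arm -/(_ _ xz)[_ [y exy zE]] : in_multipole (induced e T) z.
      by rewrite -supp sz.
    by exists y => //; move: sz; rewrite zE sk // => -[].
  by case=> y exy ->; exists (arm T x y); rewrite arm_incident sk /=.
have edgeP x y : [set x; y] \in medges (induced e T) = [&& x \in T, y \in T & e x y].
  rewrite /= inE subUset !sub1set; apply/andP/and3P => [[/imsetP[[a b]]]|[xT yT exy]].
    rewrite inE /edge_of /= => eab E /andP[xT yT]; split=> //.
    have: a \in [set x; y] by rewrite E !inE eqxx.
    rewrite !inE => /orP[] /eqP aE; subst a.
      by rewrite (set2_inj E).
    by rewrite symE; move: E; rewrite setUC => /set2_inj ->.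
  by split; [apply/imsetP; exists (x, y); rewrite ?inE | apply/andP].
split.
  case=> -[_ proper] normal; split.
  - move=> x y xT yT exy; have := sk x xT y exy.
    by rewrite arm_sym // sk 1?symE // => -[].
  - move=> x xT y z exy exz kyz; apply/eqP/negPn/negP => /eqP yz.
    have := @proper x (arm T x y) (arm T x z) xT; rewrite !sk // kyz.
    by case=> //; rewrite ?arm_in ?arm_incident // => /arm_inj.
  by move=> x y xT yT exy; rewrite -!pal // normal // edgeP xT yT.
case=> _ inj normal; split; last first.
  by move=> x y; rewrite edgeP => /and3P[xT yT exy]; rewrite !pal //; apply: normal.
split=> // x z1 z2 xT /incident_arm P1 /incident_arm P2 /P1[_ [y1 e1 ->]].
move=> /P2[_ [y2 e2 ->]] ne; rewrite !sk // => -[] /inj E.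
by apply: ne; rewrite E.
Qed.

Lemma hue_normal T s : normal_coloring (induced e T) s -> normal_on T (hue s).
Proof.
move=> ns; have supp : supported T s by case: ns => -[].
have sk : {in T, forall x y, e x y -> s (arm T x y) = Some (hue s x y)}.
  by move=> x xT y; apply: arm_hue.
by case: (normal_coloringP supp sk) => + _; apply.
Qed.

(** Every edge and every semiedge is an arm of some vertex of [T], so that the
    half-edge colors determine the coloring. *)
Lemma supported_inj T s1 s2 : supported T s1 -> supported T s2 ->
  {in T, forall x y, e x y -> hue s1 x y = hue s2 x y} -> s1 = s2.
Proof.
move=> supp1 supp2 eq12; apply/ffunP=> z.
case zM: (in_multipole (induced e T) z); last first.
  by have := supp1 z; have := supp2 z; rewrite zM; do 2!case: (_ z).
have [x xz] : exists x, incident x z.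
  case: z zM => [E|[x y]] /=; last by exists x.
  rewrite inE => /andP[/imsetP[[x y] _ ->] _]; exists x.
  by rewrite /edge_of !inE eqxx.
by have [xT [y exy ->]] := incident_arm zM xz; rewrite !arm_hue // eq12.
Qed.

(** The coloring with given half-edge colors.  An edge is a set of two vertices,
    so one of its two orientations has to be picked; [normal_on] makes the
    choice immaterial. *)
Definition paint T k : coloring V :=
  [ffun z => if in_multipole (induced e T) z then
     Some match z with
     | inl E => if [pick h | e h.1 h.2 & edge_of h == E] is Some h
                then k h.1 h.2 else ord0
     | inr h => k h.1 h.2
     end else None].

Lemma paint_supported T k : supported T (paint T k).
Proof. by move=> z; rewrite ffunE; case: ifP. Qed.

Lemma paint_arm T k : normal_on T k ->
  {in T, forall x y, e x y -> paint T k (arm T x y) = Some (k x y)}.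
Proof.
case=> symk _ _ x xT y exy; rewrite ffunE arm_in // /arm; case: ifP => // yT.
case: pickP => [[a b] /= /andP[eab /eqP E]|/(_ (x, y))]; last by rewrite /= exy eqxx.
rewrite /edge_of /= in E; have: x \in [set a; b] by rewrite E !inE eqxx.
rewrite !inE => /orP[] /eqP xE; subst x; first by rewrite (set2_inj E).
by move: E; rewrite setUC => /set2_inj E; subst y; rewrite symk.
Qed.

Lemma paint_normal T k : normal_on T k -> normal_coloring (induced e T) (paint T k).
Proof.
by move=> nk; case: (normal_coloringP (paint_supported T k) (paint_arm nk)) => _; apply.
Qed.

Lemma paint_hue T k : normal_on T k ->
  {in T, forall x y, e x y -> hue (paint T k) x y = k x y}.
Proof.
move=> nk x xT y exy; have := arm_hue (paint_supported T k) xT exy.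
by rewrite (paint_arm nk) // => -[].
Qed.

Lemma restrict_hue T T' s : supported T s -> T' \subset T ->
  {in T', forall x y, e x y -> hue (restrict (induced e T') s) x y = hue s x y}.
Proof.
move=> supp /subsetP sub x xT' y exy; congr odflt; rewrite /arm_color_opt !ffunE /=.
have xT := sub _ xT'; rewrite !inE /= exy xT' /=; case: ifP => yT' /=.
  rewrite /edge_of /=; case: (s (inr _)) => //; case: (s (inl _)) => //.
  by rewrite if_same.
move/negbFE: yT' => yT'; have yT := sub _ yT'.
have := supp (inr (x, y)); rewrite /= inE /= yT !andbF.
case: (s (inr _)) => // _; rewrite subUset !sub1set xT' yT' andbT.
by case: imsetP => // -[]; exists (x, y); rewrite ?inE.
Qed.

Lemma restrict_supported T T' s : supported T s -> T' \subset T ->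
  supported T' (restrict (induced e T') s).
Proof.
move=> supp sub z; rewrite ffunE; case: ifP => // zM.
case: z zM => [E|[x y]].
  move=> EM; rewrite supp; move: EM; rewrite /= !inE => /andP[-> ET'].
  exact: subset_trans sub.
rewrite /= inE /= => /and3P[exy xT' yT'].
have xT := subsetP sub _ xT'.
have := arm_color supp xT exy; rewrite (arm_hue supp) // /arm_color_opt.
by case: (s (inr _)) => // <-.
Qed.

(** An edge inside [T1 :|: T2] that is inside neither set joins [T1 :\: T2] to
    [T2 :\: T1]: it is a semiedge of both multipoles, one half in each, and the
    union closes it up. *)
Lemma munion_induced T1 T2 :
  munion e (induced e T1) (induced e T2) = induced e (T1 :|: T2).
Proof.
have edges : union_edges e (induced e T1) (induced e T2) =
             medges (induced e (T1 :|: T2)).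
  apply/setP=> E; rewrite !inE /=; case EG: (E \in _) => //=.
  case/imsetP: EG => -[x y]; rewrite inE /edge_of /= => exy ->.
  have xyG : [set x; y] \in graph_edges e by apply/imsetP; exists (x, y); rewrite ?inE.
  rewrite !subUset !sub1set !inE.
  apply/or3P/idP => [[/andP[-> ->]//|/andP[-> ->]|]|]; rewrite ?orbT //.
    case/existsP=> a /existsP[b] /and3P[/eqP xyE]; rewrite /= !inE /=.
    move=> /and3P[_ aT _] /and3P[_ bT _].
    have: [set x; y] \subset T1 :|: T2.
      by rewrite xyE subUset !sub1set !inE aT bT orbT.
    by rewrite subUset !sub1set !inE.
  case/andP; case x1: (x \in T1); case y1: (y \in T1); case x2: (x \in T2);
    case y2: (y \in T2) => //= _ _; try by [constructor 1|constructor 2].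
  - constructor 3; apply/existsP; exists x; apply/existsP; exists y.
    by rewrite !inE /= eqxx exy symE exy x1 x2 y1 y2.
  - constructor 3; apply/existsP; exists y; apply/existsP; exists x.
    by rewrite !inE /= setUC eqxx exy symE exy x1 x2 y1 y2.
rewrite /munion edges /induced; congr Multipole; apply/setP=> -[x y]; rewrite !inE /=.
case exy: (e x y) => //=.
have xyG : [set x; y] \in graph_edges e by apply/imsetP; exists (x, y); rewrite ?inE.
rewrite /edge_of /= xyG subUset !sub1set !inE /=.
by do 4!case: (_ \in _).
Qed.

End HalfEdges.

(** This is what allows one to fix the pentagon and the names of the colors. *)
Lemma normal_on_transport (V W : finType) (e : rel V) (e' : rel W) (f : W -> V)
    (r : 'I_5 -> 'I_5) T k : bijective f ->
    (forall x y, e' x y = e (f x) (f y)) -> injective r ->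
  normal_on e T k -> normal_on e' (f @^-1: T) (fun x y => r (k (f x) (f y))).
Proof.
move=> bij ee injr [symk injk nk]; have injf := bij_inj bij; case: bij => g _ gK.
have pal x : palette e' (fun x y => r (k (f x) (f y))) x = r @: palette e k (f x).
  rewrite /palette; apply/setP=> c; apply/imsetP/imsetP.
    case=> y; rewrite unfold_in ee => exy ->; exists (k (f x) (f y)) => //.
    exact: imset_f.
  case=> _ /imsetP[y exy ->] ->; exists (g y); rewrite ?gK // unfold_in ee gK.
  by [].
split=> [x y|x|x y]; rewrite !inE.
- by move=> xT yT; rewrite ee => exy; rewrite symk.
- move=> xT y z; rewrite /= !unfold_in !ee => exy exz /injr /injk E; apply/injf/E.
  + by [].
  + exact: exy.
  exact: exz.
move=> xT yT; rewrite ee => exy; rewrite !pal -imsetU card_imset //.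
by have := nk _ _ xT yT exy; rewrite !inE.
Qed.

(** * Normality in terms of lists of neighbors *)

(** Normality of an edge, for the lists of colors at its two ends.  Colors are
    natural numbers here so that the searches below compute. *)
Definition normal_pair (P Q : seq nat) : bool := size (undup (P ++ Q)) \in [:: 3; 5].

Definition hues (V : finType) (nb : V -> seq V) (k : V -> V -> 'I_5) x : seq nat :=
  [seq (k x y : nat) | y <- nb x].

Lemma uniq_map_inj (S R : eqType) (f : S -> R) s :
  uniq (map f s) -> {in s &, injective f}.
Proof.
move=> uni y z ys zs fyz; rewrite -(nth_index y ys) -(nth_index y zs).
congr nth; move/(uniqP (f y)): uni => /(_ (index y s) (index z s)).
by apply; rewrite ?inE ?size_map ?index_mem // !(nth_map y) ?index_mem // !nth_index.
Qed.

Section NeighborLists.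
Variables (V : finType) (e : rel V) (nb : V -> seq V).
Hypotheses (nbE : forall x y, e x y = (y \in nb x)) (nb_uniq : forall x, uniq (nb x)).
Implicit Types (T : {set V}) (k : V -> V -> 'I_5).

Lemma normal_on_nb T k :
  normal_on e T k <->
  [/\ {in T &, forall x y, y \in nb x -> k x y = k y x},
      {in T, forall x, uniq (hues nb k x)} &
      {in T &, forall x y, y \in nb x ->
         normal_pair (hues nb k x) (hues nb k y)}].
Proof.
have pal x y : #|palette e k x :|: palette e k y| =
               size (undup (hues nb k x ++ hues nb k y)).
  rewrite /hues ![[seq (k _ _ : nat) | _ <- _]]map_comp -map_cat undup_map_inj ?size_map.
    rewrite -(card_uniqP (undup_uniq _)); apply: eq_card => c.
    rewrite mem_undup mem_cat in_setU; congr orb;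
      by apply/imsetP/mapP => -[z]; rewrite ?unfold_in ?nbE => zx ->;
         exists z; rewrite // unfold_in nbE.
  exact: val_inj.
have uniqE x : {in e x &, injective (k x)} <-> uniq (hues nb k x).
  rewrite /hues map_comp (map_inj_uniq val_inj); split=> [inj|].
    by rewrite map_inj_in_uniq // => y z yx zx; apply: inj; rewrite unfold_in nbE.
  move=> /uniq_map_inj inj y z; rewrite !unfold_in !nbE => yx zx; exact: inj.
split=> -[symk uni nor]; split.
- by move=> x y xT yT yx; apply: symk => //; rewrite nbE.
- by move=> x xT; apply/uniqE/uni.
- by move=> x y xT yT yx; rewrite /normal_pair -pal; apply: nor => //; rewrite nbE.
- by move=> x y xT yT; rewrite nbE => yx; apply: symk.
- by move=> x xT; apply/uniqE/uni.
by move=> x y xT yT; rewrite nbE pal => yx; apply: nor.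
Qed.

End NeighborLists.

(** * Searches over the five colors *)

Lemma each_color (C P : pred nat) :
  all (fun c => if C c then P c else true) (iota 0 5) ->
  forall c : 'I_5, C c -> P c.
Proof.
by move=> /allP all5 c Cc; have := all5 c; rewrite Cc mem_iota /=; apply.
Qed.

Arguments each_color {C P} all_c c Cc.

Lemma any_color (P : pred nat) : all P (iota 0 5) -> forall c : 'I_5, P c.
Proof. by move=> /allP all5 c; apply: all5; rewrite mem_iota /=. Qed.
Arguments any_color {P} all_c c.

(* A conditional rather than an implication: the branches that violate [C] must
   not be evaluated. *)
Notation "'each' x 'with' C , P" :=
  (all (fun x : nat => if C then P else true) (iota 0 5))
  (at level 200, x name, C at level 99, P at level 200).
Notation "'each' x , P" := (all (fun x : nat => P) (iota 0 5))
  (at level 200, x name, P at level 200).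

(** Here [x_i], [y_i], [z_i] color u_i u_(i+1), u_i v_i and v_i v_(i+2).  The
    conclusion is only stated for [y0] and [z0]; rotating the pentagon gives the
    other indices. *)
Lemma petersen_search :
  each x4, each x0, each y0 with uniq [:: y0; x0; x4],
  each x1, each y1 with
    uniq [:: y1; x1; x0] && normal_pair [:: y0; x0; x4] [:: y1; x1; x0],
  each x2, each y2 with
    uniq [:: y2; x2; x1] && normal_pair [:: y1; x1; x0] [:: y2; x2; x1],
  each x3, each y3 with
    uniq [:: y3; x3; x2] && normal_pair [:: y2; x2; x1] [:: y3; x3; x2],
  each y4 with
    [&& uniq [:: y4; x4; x3], normal_pair [:: y3; x3; x2] [:: y4; x4; x3]
      & normal_pair [:: y4; x4; x3] [:: y0; x0; x4]],
  each z0, each z3 with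
    uniq [:: y0; z0; z3] && normal_pair [:: y0; x0; x4] [:: y0; z0; z3],
  each z2 with
    [&& uniq [:: y2; z2; z0], normal_pair [:: y2; x2; x1] [:: y2; z2; z0]
      & normal_pair [:: y0; z0; z3] [:: y2; z2; z0]],
  each z4 with
    [&& uniq [:: y4; z4; z2], normal_pair [:: y4; x4; x3] [:: y4; z4; z2]
      & normal_pair [:: y2; z2; z0] [:: y4; z4; z2]],
  each z1 with
    [&& uniq [:: y1; z1; z4], normal_pair [:: y1; x1; x0] [:: y1; z1; z4],
        uniq [:: y3; z3; z1] & normal_pair [:: y3; x3; x2] [:: y3; z3; z1]],
  [&& uniq [:: x0; x1; x2; x3; x4], y0 == x2 & z0 == x3].
Proof. by vm_compute. Qed.

(** Colors are counted from [i].  [p], [q], [r] color u_i a_i, u_i a_(i-1) and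
    a_i b_i, and [p'], [q'] are the analogues of [p], [q] at u_(i+1); the lists of
    constants are the colors at v_i and v_(i+1), and 2 and 3 are the colors of
    the spokes. *)
Lemma extension_search :
  each p, each q with uniq [:: 2; p; q] && normal_pair [:: 2; p; q] [:: 2; 3; 1],
  each p', each q' with uniq [:: 3; p'; q'] && normal_pair [:: 3; p'; q'] [:: 3; 4; 2],
  each r with [&& uniq [:: r; p; q'], normal_pair [:: 2; p; q] [:: r; p; q']
              & normal_pair [:: r; p; q'] [:: 3; p'; q']],
  [:: p; q; r; p'] \in [:: [:: 1; 3; 0; 2]; [:: 0; 4; 3; 0]; [:: 4; 0; 2; 1]].
Proof. by vm_compute. Qed.

(** [Q] holds for the colors at c, g, d, h, the color of the edge leaving the
    superedge coming first, in every normal coloring of a superedge in which a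
    sees the colors 0 (towards b), 1 and 4.  Passing the property as an argument
    lets two such enumerations be nested. *)
Definition each_superedge (Q : seq nat -> seq nat -> seq nat -> seq nat -> bool) :=
  each be, each bf with uniq [:: 0; be; bf] && normal_pair [:: 0; 1; 4] [:: 0; be; bf],
  each de, each eg with
    uniq [:: be; de; eg] && normal_pair [:: 0; be; bf] [:: be; de; eg],
  each cf, each fh with
    uniq [:: bf; cf; fh] && normal_pair [:: 0; be; bf] [:: bf; cf; fh],
  each cd, each c with
    uniq [:: c; cd; cf] && normal_pair [:: c; cd; cf] [:: bf; cf; fh],
  each d with
    [&& uniq [:: d; cd; de], normal_pair [:: c; cd; cf] [:: d; cd; de]
      & normal_pair [:: d; cd; de] [:: be; de; eg]],
  each gh, each g with
    uniq [:: g; eg; gh] && normal_pair [:: be; de; eg] [:: g; eg; gh],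
  each h with
    [&& uniq [:: h; fh; gh], normal_pair [:: bf; cf; fh] [:: h; fh; gh]
      & normal_pair [:: g; eg; gh] [:: h; fh; gh]],
  Q [:: c; cd; cf] [:: g; eg; gh] [:: d; cd; de] [:: h; fh; gh].

Lemma superedge_not_both_sides :
  each_superedge (fun c g d h => ~~ ((head 0 c == head 0 g) && (head 0 d == head 0 h))).
Proof. by vm_compute. Qed.

(** Colors counted from [ordS i] are converted to colors counted from [i]. *)
Definition turn (c : nat) := (c + 1) %% 5.

(** The primed superedge is the next one, so its colors are turned by one step;
    the conclusion concerns the two edges that link the superedges. *)
Lemma linked_superedges :
  each_superedge (fun c g d h => each_superedge (fun c' g' d' h' =>
    let c1 := map turn c' in let g1 := map turn g' in
    [&& head 0 d == head 0 c1, head 0 h == head 0 g1,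
        normal_pair d c1 & normal_pair h g1] ==> (head 0 d == head 0 h))).
Proof. by vm_compute. Qed.

(** * The Petersen graph and the superposition along its outer pentagon *)

Notation SV := (sup_vertex petersen_vertex).

Definition indices : seq 'I_5 := [seq inZp n | n <- iota 0 5].
Definition letters := [:: La; Lb; Lc; Ld; Le; Lf; Lg; Lh].
Definition petersen_vertices : seq petersen_vertex := map inl indices ++ map inr indices.
Definition sup_vertices : seq SV :=
  map inl petersen_vertices ++ [seq inr (i, p) | i <- indices, p <- letters].

Lemma mem_indices i : i \in indices.
Proof. by rewrite -(valZpK i); apply: map_f; rewrite mem_iota add0n ltn_ord. Qed.

Lemma mem_petersen_vertices x : x \in petersen_vertices.
Proof. by rewrite mem_cat; case: x => i; rewrite map_f ?mem_indices ?orbT. Qed.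

Lemma mem_sup_vertices x : x \in sup_vertices.
Proof.
rewrite mem_cat; case: x => [x|[i p]]; first by rewrite map_f ?mem_petersen_vertices.
by apply/orP; right; apply/allpairsP; exists (i, p); rewrite mem_indices; case: p.
Qed.

(** Quantification over explicit enumerations, unlike over [enum], computes. *)
Lemma all_sup (P : pred SV) : all P sup_vertices -> forall x, P x.
Proof. by move=> /allP allPx x; apply/allPx/mem_sup_vertices. Qed.

Lemma all_petersen (P : pred petersen_vertex) : all P petersen_vertices -> forall x, P x.
Proof. by move=> /allP allPx x; apply/allPx/mem_petersen_vertices. Qed.

Lemma all_indices (P : pred 'I_5) : all P indices -> forall x, P x.
Proof. by move=> /allP allPx x; apply/allPx/mem_indices. Qed.

Lemma ordS5 i : ordS (ordS (ordS (ordS (ordS i)))) = i :> 'I_5.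
Proof. by apply/eqP; move: i; apply: all_indices. Qed.

Definition petersen_nb (x : petersen_vertex) : seq petersen_vertex :=
  match x with
  | inl i => [:: inr i; inl (ordS i); inl (ord_pred i)]
  | inr i => [:: inl i; inr (ordS (ordS i)); inr (ord_pred (ord_pred i))]
  end.

Lemma petersen_nbE x y : petersen x y = (y \in petersen_nb x).
Proof.
by apply/eqP; move: y; apply: all_petersen; move: x; apply: all_petersen; vm_compute.
Qed.

Lemma petersen_nb_uniq x : uniq (petersen_nb x).
Proof. by move: x; apply: all_petersen; vm_compute. Qed.

Definition sup_nb (x : SV) : seq SV :=
  match x with
  | inl (inl i) => [:: inl (inr i); inr (i, La); inr (ord_pred i, La)]
  | inl (inr i) => map inl (petersen_nb (inr i))
  | inr (i, p) =>
    match p with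
    | La => [:: inr (i, Lb); inl (inl i); inl (inl (ordS i))]
    | Lb => [:: inr (i, La); inr (i, Le); inr (i, Lf)]
    | Lc => [:: inr (ord_pred i, Ld); inr (i, Ld); inr (i, Lf)]
    | Ld => [:: inr (ordS i, Lc); inr (i, Lc); inr (i, Le)]
    | Le => [:: inr (i, Lb); inr (i, Ld); inr (i, Lg)]
    | Lf => [:: inr (i, Lb); inr (i, Lc); inr (i, Lh)]
    | Lg => [:: inr (ord_pred i, Lh); inr (i, Le); inr (i, Lh)]
    | Lh => [:: inr (ordS i, Lg); inr (i, Lf); inr (i, Lg)]
    end
  end.

Notation std_sup := (superposition petersen (@inl 'I_5 'I_5)).

Lemma cycle_edge_inl v w : cycle_edge (@inl 'I_5 'I_5) v w =
  match v, w with inl i, inl j => (j == ordS i) || (i == ordS j) | _, _ => false end.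
Proof.
apply/existsP/idP => [[i /eqP E]|].
  have: v \in [set v; w] by rewrite !inE eqxx.
  rewrite E !inE => /orP[] /eqP vE; subst v.
    by rewrite (set2_inj E) eqxx.
  by move: E; rewrite [RHS]setUC => /set2_inj ->; rewrite eqxx orbT.
case: v w => [i|//] [j|//] /orP[] /eqP->.
  by exists i.
by exists j; rewrite setUC.
Qed.

Lemma sup_nbE x y : std_sup x y = (y \in sup_nb x).
Proof.
pose arc (x y : SV) := match x, y with
  | inl v, inl w => petersen v w && ~~ match v, w with
      inl i, inl j => (j == ordS i) || (i == ordS j) | _, _ => false end
  | _, _ => sup_arc petersen inl x y end.
have arcE a b : sup_arc petersen inl a b = arc a b.
  by case: a b => [v|a] [w|b] //=; rewrite cycle_edge_inl.
rewrite /superposition !arcE; apply/eqP.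
by move: y; apply: all_sup; move: x; apply: all_sup; vm_compute.
Qed.

Lemma sup_nb_uniq x : uniq (sup_nb x).
Proof. by move: x; apply: all_sup; vm_compute. Qed.

(** * Pentagons and normal colorings of the Petersen graph *)

(** The only candidate for an automorphism carrying the outer pentagon to [us]:
    v_i has to go to the third neighbor of the image of u_i. *)
Definition pentagon_map (us : seq petersen_vertex) (x : petersen_vertex) :
    petersen_vertex :=
  match x with
  | inl i => nth (inl ord0) us i
  | inr i => head (inl ord0)
      [seq w <- petersen_nb (nth (inl ord0) us i) | w \notin us]
  end.

Definition pentagon_good us :=
  uniq (map (pentagon_map us) petersen_vertices) &&
  allrel (fun x y => petersen x y == petersen (pentagon_map us x) (pentagon_map us y))
    petersen_vertices petersen_vertices.

(** As the Petersen graph has no triangle, the two inequalities are enough for a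
    closed walk of length 5 to have five distinct vertices. *)
Lemma pentagon_search :
  all (fun u0 => all (fun u1 => all (fun u2 => if u2 == u0 then true else
  all (fun u3 => if u3 == u1 then true else
  all (fun u4 => if u0 \in petersen_nb u4
                 then pentagon_good [:: u0; u1; u2; u3; u4] else true)
    (petersen_nb u3)) (petersen_nb u2)) (petersen_nb u1)) (petersen_nb u0))
    petersen_vertices.
Proof. by vm_compute. Qed.

(** The automorphism group of the Petersen graph is transitive on its oriented,
    rooted pentagons. *)
Lemma petersen_embedding u : five_cycle petersen u ->
  exists f : petersen_vertex -> petersen_vertex, [/\ bijective f,
    forall x y, petersen x y = petersen (f x) (f y) & forall i, f (inl i) = u i].
Proof.
case=> injU cycU; pose us := [seq u i | i <- indices].
have good : pentagon_good us.
  have adj n : u (inZp n.+1) \in petersen_nb (u (inZp n)).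
    have -> : inZp n.+1 = ordS (inZp n) :> 'I_5.
      by apply/val_inj; rewrite /= -addn1 -[in RHS]addn1 modnDml.
    by rewrite -petersen_nbE.
  have adj4 : u (inZp 0) \in petersen_nb (u (inZp 4)).
    by rewrite (_ : inZp 0 = inZp 5 :> 'I_5) ?adj //; apply/val_inj.
  have := all_petersen pentagon_search (u (inZp 0)).
  move=> /allP/(_ _ (adj 0))/allP/(_ _ (adj 1)); rewrite (inj_eq injU).
  move=> /allP/(_ _ (adj 2)); rewrite (inj_eq injU).
  by move=> /allP/(_ _ (adj 3)); rewrite adj4.
case/andP: good => uni /allP rel; exists (pentagon_map us); split.
- apply: injF_bij => x y; apply: (uniq_map_inj uni); exact: mem_petersen_vertices.
- move=> x y; apply/eqP; have /allP := rel x (mem_petersen_vertices x).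
  by apply; apply: mem_petersen_vertices.
move=> i; rewrite /pentagon_map /us (nth_map ord0) ?size_map ?size_iota //.
by rewrite (nth_map 0) ?size_iota // nth_iota // valZpK.
Qed.

(** The color permutation [r] sends [i] to the color of u_i u_(i+1). *)
Lemma petersen_coloring k : normal_on petersen [set: petersen_vertex] k ->
  exists2 r : 'I_5 -> 'I_5, injective r & forall i,
    [/\ k (inr i) (inl i) = r (ordS (ordS i)),
        k (inr i) (inr (ordS (ordS i))) = r (ordS (ordS (ordS i)))
      & k (inr i) (inr (ord_pred (ord_pred i))) = r (ordS i)].
Proof.
move=> /(normal_on_nb petersen_nbE petersen_nb_uniq)[symk uni nor].
pose x i := k (inl i) (inl (ordS i)).
pose y i := k (inl i) (inr i).
pose z i := k (inr i) (inr (ordS (ordS i))).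
have {}symk a b : b \in petersen_nb a -> k a b = k b a.
  by move=> ab; apply: symk => //; rewrite inE.
have US i : hues petersen_nb k (inl (ordS i)) =
    [:: y (ordS i) : nat; x (ordS i) : nat; x i : nat].
  rewrite /hues /= ordSK [k (inl (ordS i)) (inl i)]symk //.
  by rewrite /= ordSK !inE eqxx !orbT.
have VS i : hues petersen_nb k (inr (ordS (ordS i))) =
    [:: y (ordS (ordS i)) : nat; z (ordS (ordS i)) : nat; z i : nat].
  rewrite /hues /= !ordSK [k (inr _) (inr i)]symk ?[k (inr _) (inl _)]symk //;
    by rewrite !inE ?ordSK ?eqxx ?orbT.
have Un i : uniq [:: y (ordS i) : nat; x (ordS i) : nat; x i : nat].
  by rewrite -US uni ?inE.
have Vn i : uniq [:: y (ordS (ordS i)) : nat; z (ordS (ordS i)) : nat; z i : nat].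
  by rewrite -VS uni ?inE.
have UU i : normal_pair [:: y (ordS i) : nat; x (ordS i) : nat; x i : nat]
    [:: y (ordS (ordS i)) : nat; x (ordS (ordS i)) : nat; x (ordS i) : nat].
  by rewrite -!US; apply: nor; rewrite ?inE ?eqxx ?orbT.
have UV i : normal_pair
    [:: y (ordS (ordS i)) : nat; x (ordS (ordS i)) : nat; x (ordS i) : nat]
    [:: y (ordS (ordS i)) : nat; z (ordS (ordS i)) : nat; z i : nat].
  by rewrite -US -VS; apply: nor; rewrite ?inE ?eqxx ?orbT.
have VV i : normal_pair
    [:: y (ordS (ordS i)) : nat; z (ordS (ordS i)) : nat; z i : nat]
    [:: y (ordS (ordS (ordS (ordS i)))) : nat; z (ordS (ordS (ordS (ordS i)))) : nat;
        z (ordS (ordS i)) : nat].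
  by rewrite -!VS; apply: nor; rewrite ?inE ?eqxx ?orbT.
have local i : [&& uniq [:: x i : nat; x (ordS i) : nat; x (ordS (ordS i)) : nat;
    x (ordS (ordS (ordS i))) : nat; x (ordS (ordS (ordS (ordS i)))) : nat],
    y i == x (ordS (ordS i)) :> nat & z i == x (ordS (ordS (ordS i))) :> nat].
  pose i1 := ordS i; pose i2 := ordS i1; pose i3 := ordS i2; pose i4 := ordS i3.
  have U0 := Un i4; have V0 := Vn i3; have V1 := Vn i4.
  have UU3 := UU i3; have UU4 := UU i4; have UV0 := UV i3; have UV1 := UV i4.
  have VV1 := VV i4; have VV0 := VV i3.
  rewrite !ordS5 in U0 V0 V1 UU3 UU4 UV0 UV1 VV0 VV1.
  move: petersen_search => /any_color/(_ (x i4))/any_color/(_ (x i)).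
  move=> /each_color/(_ (y i) U0)/any_color/(_ (x i1)).
  move=> /each_color/(_ (y i1) (introT andP (conj (Un i) UU4))).
  move=> /any_color/(_ (x i2)).
  move=> /each_color/(_ (y i2) (introT andP (conj (Un i1) (UU i)))).
  move=> /any_color/(_ (x i3)).
  move=> /each_color/(_ (y i3) (introT andP (conj (Un i2) (UU i1)))).
  move=> /each_color/(_ (y i4) (introT and3P (And3 (Un i3) (UU i2) UU3))).
  move=> /any_color/(_ (z i)).
  move=> /each_color/(_ (z i3) (introT andP (conj V0 UV0))).
  move=> /each_color/(_ (z i2) (introT and3P (And3 (Vn i) (UV i) VV0))).
  move=> /each_color/(_ (z i4) (introT and3P (And3 (Vn i2) (UV i2) (VV i)))).
  by move=> /each_color/(_ (z i1) (introT and4P (And4 V1 UV1 (Vn i1) (UV i1)))).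
exists x => [|i].
  pose turns := [:: ord0; ordS ord0; ordS (ordS ord0); ordS (ordS (ordS ord0));
                    ordS (ordS (ordS (ordS ord0)))] : seq 'I_5.
  have mem_turns c : c \in turns by move: c; apply: all_indices; vm_compute.
  have /and3P[uni0 _ _] := local ord0.
  by move=> a b /(congr1 val); apply: (@uniq_map_inj _ _ (fun i => x i : nat) turns).
have xyz j : y j = x (ordS (ordS j)) /\ z j = x (ordS (ordS (ordS j))).
  by have /and3P[_ /eqP/val_inj yE /eqP/val_inj zE] := local j.
split; first by rewrite -(proj1 (xyz i)) symk // !inE eqxx.
  exact: (proj2 (xyz i)).
rewrite -[i]ord_predK -[ord_pred i]ord_predK !ordSK -(proj2 (xyz _)) symk //.
by rewrite !inE !ordSK eqxx !orbT.
Qed.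

(** * The coloring of the exterior *)

Definition shift n (i : 'I_5) : 'I_5 := inZp (i + n).

(** The forced coloring of the exterior, when u_i u_(i+1) had color [i] in the
    Petersen graph: spokes have color i+2, v_i v_(i+2) has i+3, u_i a_i has i+1,
    a_i u_(i+1) has i-1 and a_i b_i has i.  Each line reads the color from the
    first vertex, so that e.g. the edge from u_i back to a_(i-1) has color
    (i-1)-1 = i+3. *)
Definition ext_color (x y : SV) : 'I_5 :=
  match x, y with
  | inl (inl i), inr (j, _) => if j == i then shift 1 i else shift 3 i
  | inl (inl i), inl _ => shift 2 i
  | inl (inr i), inl (inr j) => if j == ordS (ordS i) then shift 3 i else shift 1 i
  | inl (inr i), _ => shift 2 i
  | inr (i, _), inl (inl j) => if j == i then shift 1 i else shift 4 i
  | inr (i, _), _ => i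
  end.

Definition in_ext (x : SV) : bool := if x is inr (_, p) then p == La else true.

Lemma ext_color_normal : normal_on std_sup [set x | in_ext x] ext_color.
Proof.
apply/(normal_on_nb sup_nbE sup_nb_uniq); split.
- move=> x y; rewrite !inE => xT yT xy; apply/eqP.
  have /all_sup/(_ x)/allP/(_ y xy) : all (fun x => all (fun y =>
    in_ext x ==> in_ext y ==> (ext_color x y == ext_color y x)) (sup_nb x)) sup_vertices.
    by vm_compute.
  by rewrite xT yT.
- move=> x; rewrite inE; apply/implyP.
  by move: x; apply: all_sup; vm_compute.
move=> x y; rewrite !inE => xT yT xy.
have /all_sup/(_ x)/allP/(_ y xy) : all (fun x => all (fun y =>
  in_ext x ==> in_ext y ==>
  normal_pair (hues sup_nb ext_color x) (hues sup_nb ext_color y)) (sup_nb x)) sup_vertices.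
  by vm_compute.
by rewrite xT yT.
Qed.

Arguments shift : simpl never.

(** The color [c] counted from [i], i.e. c - i modulo 5.  In these relative colors
    the situation at every index is the same, and a search for one index is
    enough. *)
Definition relative (i c : 'I_5) : 'I_5 := shift (5 - i) c.
Arguments relative : simpl never.

Lemma relativeK i : cancel (relative i) (fun n => shift n i).
Proof.
move=> c; apply/eqP.
by move: c; apply: all_indices; move: i; apply: all_indices; vm_compute.
Qed.

Lemma normal_on_relative (V : finType) (e : rel V) T k i : normal_on e T k ->
  normal_on e T (fun x y => relative i (k x y)).
Proof.
move=> /(normal_on_transport (f := id) _ (fun x y => erefl) (can_inj (relativeK i))).
rewrite (_ : id @^-1: T = T); last by apply/setP=> x; rewrite inE.
by apply; exists id.
Qed.

(** The local rule for the pair of colors at u_i: the second and third cases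
    swap the roles of the two new edges from one vertex of the cycle to the
    next, the first one reproduces itself. *)
Lemma extension_step k i :
    normal_on std_sup [set x | in_ext x] k ->
    hues sup_nb k (inl (inr i)) = [:: 2; 3; 1] ->
    hues sup_nb k (inl (inr (ordS i))) = [:: 3; 4; 2] ->
  let p := k (inl (inl i)) (inr (i, La)) in
  let q := k (inl (inl i)) (inr (ord_pred i, La)) in
  let r := k (inr (i, La)) (inr (i, Lb)) in
  let p' := k (inl (inl (ordS i))) (inr (ordS i, La)) in
  [\/ [/\ p = 1 :> nat, q = 3 :> nat, r = 0 :> nat & p' = 2 :> nat],
      [/\ p = 0 :> nat, q = 4 :> nat, r = 3 :> nat & p' = 0 :> nat]
    | [/\ p = 4 :> nat, q = 0 :> nat, r = 2 :> nat & p' = 1 :> nat]].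
Proof.
move=> /(normal_on_nb sup_nbE sup_nb_uniq)[symk uni nor] V0 V1 p q r p'.
pose q' := k (inl (inl (ordS i))) (inr (i, La)).
have U0 : hues sup_nb k (inl (inl i)) = [:: 2; p : nat; q : nat].
  rewrite /hues /= symk ?inE ?eqxx //; congr cons.
  by case: V0.
have U1 : hues sup_nb k (inl (inl (ordS i))) = [:: 3; p' : nat; q' : nat].
  rewrite /hues /= ordSK symk ?inE ?eqxx //; congr cons.
  by case: V1.
have A0 : hues sup_nb k (inr (i, La)) = [:: r : nat; p : nat; q' : nat].
  rewrite /hues /= [k _ (inl (inl i))]symk ?[k _ (inl (inl (ordS i)))]symk //;
  by rewrite ?inE ?eqxx ?orbT.
have uni0 : uniq [:: 2; p : nat; q : nat] by rewrite -U0 uni ?inE.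
have uni1 : uniq [:: 3; p' : nat; q' : nat] by rewrite -U1 uni ?inE.
have uniA : uniq [:: r : nat; p : nat; q' : nat] by rewrite -A0 uni ?inE.
have UV0 : normal_pair [:: 2; p : nat; q : nat] [:: 2; 3; 1].
  by rewrite -U0 -V0 nor ?inE ?eqxx ?orbT.
have UV1 : normal_pair [:: 3; p' : nat; q' : nat] [:: 3; 4; 2].
  by rewrite -U1 -V1 nor ?inE ?eqxx ?orbT.
have UA : normal_pair [:: 2; p : nat; q : nat] [:: r : nat; p : nat; q' : nat].
  by rewrite -U0 -A0 nor ?inE ?eqxx ?orbT.
have AU : normal_pair [:: r : nat; p : nat; q' : nat] [:: 3; p' : nat; q' : nat].
  by rewrite -U1 -A0 nor ?inE ?eqxx ?orbT.
move: extension_search => /any_color/(_ p).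
move=> /each_color/(_ q (introT andP (conj uni0 UV0)))/any_color/(_ p').
move=> /each_color/(_ q' (introT andP (conj uni1 UV1))).
move=> /each_color/(_ r (introT and3P (And3 uniA UA AU))).
by rewrite !inE => /or3P[] /eqP[-> -> -> ->]; [constructor 1|constructor 2|constructor 3].
Qed.

(** The cases in which the pair of colors is swapped alternate along the cycle,
    which has odd length; only the self-reproducing case remains. *)
Lemma extension_forced k :
    normal_on std_sup [set x | in_ext x] k ->
    (forall i y, y \in sup_nb (inl (inr i)) ->
       k (inl (inr i)) y = ext_color (inl (inr i)) y) ->
  forall x y, in_ext x -> y \in sup_nb x -> k x y = ext_color x y.
Proof.
move=> nk kV.
have V i j : hues sup_nb (fun x y => relative i (k x y)) (inl (inr j)) =
    [seq (relative i (ext_color (inl (inr j)) y) : nat) | y <- sup_nb (inl (inr j))].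
  by apply/eq_in_map => y /kV ->.
have V0 i : [seq (relative i (ext_color (inl (inr i)) y) : nat) | y <- sup_nb (inl (inr i))]
    == [:: 2; 3; 1].
  by move: i; apply: all_indices; vm_compute.
have V1 i : [seq (relative i (ext_color (inl (inr (ordS i))) y) : nat)
    | y <- sup_nb (inl (inr (ordS i)))] == [:: 3; 4; 2].
  by move: i; apply: all_indices; vm_compute.
have step i := extension_step (normal_on_relative i nk)
  (etrans (V i i) (eqP (V0 i))) (etrans (V i (ordS i)) (eqP (V1 i))).
pose p i := k (inl (inl i)) (inr (i, La)).
have relativeE i c n : relative i c = n :> nat -> c = shift n i.
  move=> <-; exact/esym/relativeK.
have relS i c : relative (ordS i) c = (relative i c + 4) %% 5 :> nat.
  by apply/eqP; move: c; apply: all_indices; move: i; apply: all_indices; vm_compute.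
(* Relative to the next index, the color p_i goes from 0 to 4, from 4 to 0,
   and from 1 to 1; the entries at 2 and 3 are padding. *)
pose st i : nat := relative i (p i).
have stS i : st (ordS i) = nth 0 [:: 4; 1; 2; 3; 0] (st i) /\ st i \in [:: 0; 1; 4].
  by rewrite /st relS; case: (step i) => -[-> _ _ ->].
(* After five steps one is back at [i], but 0 and 4 have been exchanged. *)
have st1 i : st i = 1.
  have [S0 in0] := stS i; have [S1 _] := stS (ordS i).
  have [S2 _] := stS (ordS (ordS i)); have [S3 _] := stS (ordS (ordS (ordS i))).
  have [] := stS (ordS (ordS (ordS (ordS i)))); rewrite ordS5 S3 S2 S1 S0 => + _.
  by move: in0; rewrite !inE => /or3P[] /eqP->.
have pqr i : [/\ k (inl (inl i)) (inr (i, La)) = shift 1 i,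
    k (inl (inl i)) (inr (ord_pred i, La)) = shift 3 i
  & k (inr (i, La)) (inr (i, Lb)) = i].
  have pE : relative i (k (inl (inl i)) (inr (i, La))) = 1 :> nat := st1 i.
  case: (step i) => -[]; rewrite pE // => _ qE rE _; split.
  - exact: relativeE.
  - exact: relativeE.
  rewrite (relativeE _ _ _ rE); apply/val_inj; by rewrite /= addn0 modn_small.
have [symk _ _] := nk.
have {}symk x y : in_ext x -> in_ext y -> y \in sup_nb x -> k x y = k y x.
  by move=> xT yT; rewrite -sup_nbE; apply: symk; rewrite inE.
case=> [[i|i]|[i p0]] y //=; last first.
- move/eqP->; rewrite !inE => /or3P[] /eqP-> /=.
  + by case: (pqr i).
  + by rewrite eqxx symk ?inE ?eqxx ?orbT //; case: (pqr i).
  rewrite symk ?inE ?eqxx ?orbT //; have [_ + _] := pqr (ordS i).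
  rewrite ordSK => ->; apply/eqP; clear.
  by move: i; apply: all_indices; vm_compute.
- by move=> _; apply: kV.
move=> _; rewrite !inE => /or3P[] /eqP-> /=.
- by rewrite symk ?kV ?inE ?eqxx.
- by rewrite eqxx; case: (pqr i).
by case: (pqr i) => _ -> _; apply/eqP; clear; move: i; apply: all_indices; vm_compute.
Qed.

(** * Consecutive superedges *)

(** Each conclusion of a search over one superedge holds for the colors of any
    superedge contained in a normally colored multipole. *)
Lemma superedge_boundary T k i Q :
    normal_on std_sup T k -> (forall p, inr (i, p) \in T) ->
    hues sup_nb k (inr (i, La)) = [:: 0; 1; 4] -> each_superedge Q ->
  Q (hues sup_nb k (inr (i, Lc))) (hues sup_nb k (inr (i, Lg)))
    (hues sup_nb k (inr (i, Ld))) (hues sup_nb k (inr (i, Lh))).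
Proof.
move=> /(normal_on_nb sup_nbE sup_nb_uniq)[symk uni nor] iT A allQ.
pose kk p q := k (inr (i, p)) (inr (i, q)).
have {}symk p q : inr (i, q) \in sup_nb (inr (i, p)) -> kk p q = kk q p.
  by move=> pq; apply: symk.
pose pal p := hues sup_nb k (inr (i, p)).
have {}uni p : uniq (pal p) by apply: uni.
have {}nor p q : inr (i, q) \in sup_nb (inr (i, p)) -> normal_pair (pal p) (pal q).
  by move=> pq; apply: nor.
pose c := k (inr (i, Lc)) (inr (ord_pred i, Ld)).
pose g := k (inr (i, Lg)) (inr (ord_pred i, Lh)).
pose d := k (inr (i, Ld)) (inr (ordS i, Lc)).
pose h := k (inr (i, Lh)) (inr (ordS i, Lg)).
have B : pal Lb = [:: 0; kk Lb Le : nat; kk Lb Lf : nat].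
  rewrite /pal /hues /= -/(kk Lb La) symk ?inE ?eqxx //; congr cons; by case: A.
have E : pal Le = [:: kk Lb Le : nat; kk Ld Le : nat; kk Le Lg : nat].
  by rewrite (symk Lb) ?(symk Ld) ?inE ?eqxx ?orbT.
have F : pal Lf = [:: kk Lb Lf : nat; kk Lc Lf : nat; kk Lf Lh : nat].
  by rewrite (symk Lb) ?(symk Lc) ?inE ?eqxx ?orbT.
have C : pal Lc = [:: c : nat; kk Lc Ld : nat; kk Lc Lf : nat] by [].
have D : pal Ld = [:: d : nat; kk Lc Ld : nat; kk Ld Le : nat].
  by rewrite (symk Lc) ?inE ?eqxx ?orbT.
have G : pal Lg = [:: g : nat; kk Le Lg : nat; kk Lg Lh : nat].
  by rewrite (symk Le) ?inE ?eqxx ?orbT.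
have H : pal Lh = [:: h : nat; kk Lf Lh : nat; kk Lg Lh : nat].
  by rewrite (symk Lf) ?(symk Lg) ?inE ?eqxx ?orbT.
have uB := uni Lb; have uE := uni Le; have uF := uni Lf; have uC := uni Lc.
have uD := uni Ld; have uG := uni Lg; have uH := uni Lh.
have link p q : (p, q) \in superedge_links -> normal_pair (pal p) (pal q).
  by case: p q => -[] // _; apply: nor; rewrite !inE eqxx ?orbT.
have nAB := link La Lb isT; have nBE := link Lb Le isT; have nBF := link Lb Lf isT.
have nCD := link Lc Ld isT; have nCF := link Lc Lf isT; have nDE := link Ld Le isT.
have nEG := link Le Lg isT; have nFH := link Lf Lh isT; have nGH := link Lg Lh isT.
rewrite -!/(pal _) C G D H; rewrite [pal La]A in nAB.
rewrite B in uB nAB nBE nBF; rewrite E in uE nBE nDE nEG; rewrite F in uF nBF nCF nFH.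
rewrite C in uC nCD nCF; rewrite D in uD nCD nDE; rewrite G in uG nEG nGH.
rewrite H in uH nFH nGH.
move: allQ => /any_color/(_ (kk Lb Le)).
move=> /each_color/(_ (kk Lb Lf) (introT andP (conj uB nAB)))/any_color/(_ (kk Ld Le)).
move=> /each_color/(_ (kk Le Lg) (introT andP (conj uE nBE)))/any_color/(_ (kk Lc Lf)).
move=> /each_color/(_ (kk Lf Lh) (introT andP (conj uF nBF)))/any_color/(_ (kk Lc Ld)).
move=> /each_color/(_ c (introT andP (conj uC nCF))).
move=> /each_color/(_ d (introT and3P (And3 uD nCD nDE)))/any_color/(_ (kk Lg Lh)).
move=> /each_color/(_ g (introT andP (conj uG nEG))).
by move=> /each_color/(_ h (introT and3P (And3 uH nFH nGH))).
Qed.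

Lemma subdivision_hues k j :
    (forall j y, y \in sup_nb (inr (j, La)) ->
       k (inr (j, La)) y = ext_color (inr (j, La)) y) ->
  hues sup_nb (fun x y => relative j (k x y)) (inr (j, La)) = [:: 0; 1; 4].
Proof.
move=> kA.
transitivity [seq (relative j (ext_color (inr (j, La)) y) : nat) | y <- sup_nb (inr (j, La))].
  by apply/eq_in_map => y /kA ->.
by apply/eqP; clear; move: j; apply: all_indices; vm_compute.
Qed.

Lemma link_hues k i :
  head 0 (hues sup_nb k (inr (ordS i, Lc))) = k (inr (ordS i, Lc)) (inr (i, Ld)) /\
  head 0 (hues sup_nb k (inr (ordS i, Lg))) = k (inr (ordS i, Lg)) (inr (i, Lh)).
Proof. by rewrite /= ordSK. Qed.

(** The two edges linking consecutive superedges have equal colors: both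
    superedges are viewed in the colors counted from [i], in which the second
    one is the first one turned by one step. *)
Lemma consecutive_superedges T k i :
    normal_on std_sup T k ->
    (forall p, inr (i, p) \in T) -> (forall p, inr (ordS i, p) \in T) ->
    (forall j y, y \in sup_nb (inr (j, La)) ->
       k (inr (j, La)) y = ext_color (inr (j, La)) y) ->
  k (inr (i, Ld)) (inr (ordS i, Lc)) = k (inr (i, Lh)) (inr (ordS i, Lg)).
Proof.
move=> nk iT jT kA; pose k1 j x y := relative j (k x y).
have nk1 j : normal_on std_sup T (k1 j) by apply: normal_on_relative.
have A j : hues sup_nb (k1 j) (inr (j, La)) = [:: 0; 1; 4] := subdivision_hues j kA.
have := superedge_boundary (nk1 i) iT (A i) linked_superedges.
move=> /(superedge_boundary (nk1 (ordS i)) jT (A (ordS i))).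
have turnE x : map turn (hues sup_nb (k1 (ordS i)) x) = hues sup_nb (k1 i) x.
  rewrite /hues -map_comp; apply: eq_map => y /=; rewrite /k1.
  move: (k x y) => c; apply/eqP; clear.
  by move: c; apply: all_indices; move: i; apply: all_indices; vm_compute.
have [symk _ nor] := (normal_on_nb sup_nbE sup_nb_uniq T (k1 i)).1 (nk1 i).
have cd : inr (ordS i, Lc) \in sup_nb (inr (i, Ld)) by rewrite inE eqxx.
have gh : inr (ordS i, Lg) \in sup_nb (inr (i, Lh)) by rewrite inE eqxx.
have [cE gE] := link_hues (k1 i) i.
have cdE : head 0 (hues sup_nb (k1 i) (inr (i, Ld))) =
           head 0 (hues sup_nb (k1 i) (inr (ordS i, Lc))).
  by rewrite cE; congr nat_of_ord; apply: symk.
have ghE : head 0 (hues sup_nb (k1 i) (inr (i, Lh))) =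
           head 0 (hues sup_nb (k1 i) (inr (ordS i, Lg))).
  by rewrite gE; congr nat_of_ord; apply: symk.
cbv beta zeta; rewrite !turnE cdE ghE !eqxx !nor // -cdE -ghE => /eqP/val_inj.
exact: (can_inj (relativeK i)).
Qed.

(** The middle superedge would have equal colors on its two left edges and on
    its two right edges. *)
Lemma no_three_superedges T k i :
    normal_on std_sup T k ->
    (forall p, inr (i, p) \in T) -> (forall p, inr (ordS i, p) \in T) ->
    (forall p, inr (ordS (ordS i), p) \in T) ->
    (forall j y, y \in sup_nb (inr (j, La)) ->
       k (inr (j, La)) y = ext_color (inr (j, La)) y) ->
  False.
Proof.
move=> nk iT jT lT kA.
have ij := consecutive_superedges nk iT jT kA.
have jl := consecutive_superedges nk jT lT kA.
have nk1 := normal_on_relative (ordS i) nk.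
have := superedge_boundary nk1 jT (subdivision_hues (ordS i) kA) superedge_not_both_sides.
have [symk _ _] := nk.
have symE a b : a \in T -> b \in T -> b \in sup_nb a -> k a b = k b a.
  by move=> aT bT; rewrite -sup_nbE; apply: symk.
have [-> ->] := link_hues (fun x y => relative (ordS i) (k x y)) i.
rewrite !(symE (inr (ordS i, _)) (inr (i, _))) ?ij ?inE ?ordSK ?eqxx //.
by move: jl => /= ->; rewrite eqxx.
Qed.

(** * From the outer pentagon to an arbitrary one *)

Lemma superposition_off_cycle (V : finType) (e : rel V) u x y : symmetric e ->
  x \notin cycle_vertices u -> superposition e u (inl x) (inl y) = e x y.
Proof.
move=> symE xC.
have nc v w : x \in [set v; w] -> cycle_edge u v w = false.
  move=> vw; apply/existsP=> -[i /eqP E]; move: vw; rewrite E !inE.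
  by case/orP=> /eqP xE; case/imsetP: xC; eexists; rewrite ?xE.
by rewrite /superposition /= !nc ?inE ?eqxx ?orbT // !andbT [e y x]symE orbb.
Qed.

(** Having the prescribed restriction to M_int only concerns the half-edges at
    the vertices outside the cycle, including those towards the cycle, which are
    semiedges of M_int but edges of the larger multipole. *)
Lemma agree_on_M_int (V : finType) (e : rel V) u
    (T : {set sup_vertex V}) (s : coloring (sup_vertex V)) (sigma : coloring V) :
    symmetric e -> old_vertices V \subset T ->
    supported (superposition e u) T s -> supported e [set: V] sigma ->
  on_old (restrict (M_int e u) s) = restrict (M_int_old e u) sigma <->
  forall x y, x \notin cycle_vertices u -> e x y ->
    hue s (inl x) (inl y) = hue sigma x y.
Proof.
move=> symE sub supp_s supp_sigma.
pose N := [set (inl x : sup_vertex V) | x in ~: cycle_vertices u].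
have subN : N \subset T.
  apply: subset_trans sub; apply/subsetP=> _ /imsetP[x _ ->].
  by apply: imset_f.
have on_oldE (s' : coloring (sup_vertex V)) x y : hue (on_old s') x y = hue s' (inl x) (inl y).
  by rewrite /hue /arm_color_opt !ffunE /= imsetU1 imset_set1.
have hue_s x y : x \notin cycle_vertices u -> e x y ->
  hue (on_old (restrict (M_int e u) s)) x y = hue s (inl x) (inl y).
  move=> xC exy; rewrite on_oldE; apply: (restrict_hue supp_s subN).
    by apply: imset_f; rewrite inE.
  by rewrite superposition_off_cycle.
have hue_sigma x y : x \notin cycle_vertices u -> e x y ->
  hue (restrict (M_int_old e u) sigma) x y = hue sigma x y.
  move=> xC exy; apply: (restrict_hue supp_sigma (subsetT _)) => //.
  by rewrite inE.
split=> [E x y xC exy|agree]; first by rewrite -hue_s // E hue_sigma.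
have old_inj : injective (@old_element V).
  have inlI : injective (fun x : V => inl x : sup_vertex V) by move=> ? ? [].
  move=> [E|[x y]] [E'|[x' y']] //= [].
    by move/(imset_inj inlI) ->.
  by move=> -> ->.
have supp_rs : supported e (~: cycle_vertices u) (on_old (restrict (M_int e u) s)).
  move=> z; rewrite ffunE (restrict_supported supp_s subN).
  have [to of_] := @in_M_int V e u (old_element z) symE.
  apply/idP/idP => [/to[z' z'M /old_inj ->] //|zM].
  by apply: of_; exists z.
apply: (supported_inj symE supp_rs).
  exact: (restrict_supported supp_sigma (subsetT _)).
move=> x; rewrite inE => xC y exy.
by rewrite hue_s // hue_sigma // agree.
Qed.

Lemma superposition_iso (f : petersen_vertex -> petersen_vertex) u :
  injective f -> (forall x y, petersen x y = petersen (f x) (f y)) ->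
  (forall i, f (inl i) = u i) ->
  let F (x : SV) : SV := match x with inl v => inl (f v) | inr a => inr a end in
  forall x y, std_sup x y = superposition petersen u (F x) (F y).
Proof.
move=> injf fE fu F.
suff arcE x y : sup_arc petersen inl x y = sup_arc petersen u (F x) (F y).
  by move=> x y; rewrite /superposition !arcE.
have set2E v w a b : ([set v; w] == [set a; b]) = ([set f v; f w] == [set f a; f b]).
  by rewrite -!imset_set1 -!imsetU (inj_eq (imset_inj injf)).
case: x y => [v|[i p]] [w|[j q]] //=.
  rewrite fE; congr (_ && ~~ _); apply: eq_existsb => i.
  by rewrite set2E !fu.
by rewrite -!fu !(inj_eq injf).
Qed.

Lemma mem_superedge (V : finType) i p : inr (i, p) \in superedge V i.
Proof. exact: imset_f. Qed.

Lemma sup_nb_inr i y : (inl y \in sup_nb (inl (inr i))) = petersen (inr i) y.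
Proof. by rewrite petersen_nbE (mem_map (@inl_inj _ _)). Qed.

Theorem proposition16 (sigma : coloring petersen_vertex)
    (sigma_normal : normal_coloring (whole petersen) sigma)
    (u : 'I_5 -> petersen_vertex) (u_cycle : five_cycle petersen u) :
  exists sigma_ext : coloring (sup_vertex petersen_vertex),
    unique (fun s => normal_coloring (M_ext petersen u) s /\
              on_old (restrict (M_int petersen u) s)
              = restrict (M_int_old petersen u) sigma) sigma_ext /\
    ~ exists sigma_1 : coloring (sup_vertex petersen_vertex),
        normal_coloring (M_123 petersen u) sigma_1 /\
        compatible (superposition petersen u) (M_ext petersen u)
          (M_123 petersen u) sigma_ext sigma_1.
Proof.
have [f [bijf fE fu]] := petersen_embedding u_cycle.
have injf := bij_inj bijf.
(* [kV] speaks of the interior vertices only: there, up to the renaming [f] and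
   [r], [sigma] is the model coloring. *)
have [r injr kV] : exists2 r : 'I_5 -> 'I_5, injective r &
    forall i y, y \in sup_nb (inl (inr i)) -> if y is inl y' then
      hue sigma (f (inr i)) (f y') = r (ext_color (inl (inr i)) y) else True.
  have := hue_normal petersen_sym sigma_normal.
  move=> /(normal_on_transport bijf fE (@inj_id _))/=; rewrite preimsetT.
  case/petersen_coloring=> r injr rE; exists r => // i y.
  have [r2 r3 r1] := rE i.
  rewrite !inE => /or3P[] /eqP-> /=; rewrite ?r2 ?r3 ?r1 ?eqxx.
  - by congr r; apply/eqP; clear; move: i; apply: all_indices; vm_compute.
  - by congr r; apply/eqP; clear; move: i; apply: all_indices; vm_compute.
  rewrite (_ : _ == _ = false).
    by congr r; apply/eqP; clear; move: i; apply: all_indices; vm_compute.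
  by apply/negP/negP; clear; move: i; apply: all_indices; vm_compute.
have [r' rK r'K] : bijective r by apply: injF_bij.
pose F (x : SV) : SV := match x with inl v => inl (f v) | inr a => inr a end.
have bijF : bijective F.
  by apply: injF_bij => -[x|a] [y|b] // [/injf ->].
have FE : forall x y, std_sup x y = superposition petersen u (F x) (F y).
  exact: superposition_iso.
have [g FK gK] := bijF.
have symS := superposition_sym petersen u.
pose T := old_vertices petersen_vertex :|: [set inr (i, La) | i : 'I_5] : {set SV}.
have FT : F @^-1: T = [set x | in_ext x].
  apply/setP=> -[x|[i p]]; rewrite !inE /=.
    by rewrite imset_f.
  apply/orP/eqP => [[/imsetP[]//|/imsetP[j _ [_ ->]]//]|->].
  by right; apply: imset_f.
pose k x y := r (ext_color (g x) (g y)).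
have nk : normal_on (superposition petersen u) T k.
  rewrite (_ : T = g @^-1: [set x | in_ext x]).
    apply: normal_on_transport ext_color_normal => //; first by exists F.
    by move=> x y; rewrite FE !gK.
  by apply/setP=> x; rewrite -FT !inE gK.
have kE x y : k (F x) (F y) = r (ext_color x y) by rewrite /k !FK.
have off x : x \notin cycle_vertices u -> exists i, x = f (inr i).
  have [f' _ f'K] := bijf; rewrite -(f'K x); case: (f' x) => i; last by exists i.
  by rewrite fu; case/negP; apply: imset_f.
have supp_sigma : supported petersen [set: petersen_vertex] sigma by case: sigma_normal => -[].
have oldT : old_vertices petersen_vertex \subset T by apply: subsetUl.
have supp_ext := paint_supported (superposition petersen u) T k.
have hue_ext := paint_hue nk.
(* [k] is the model coloring of the exterior, renamed. *)
exists (paint (superposition petersen u) T k); split; first split.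
- split; first exact: paint_normal.
  have [_] := agree_on_M_int petersen_sym oldT supp_ext supp_sigma.
  apply=> x y xC xy.
  rewrite hue_ext ?superposition_off_cycle //; last 2 first.
  + by rewrite !inE imset_f.
  + exact: petersen_sym.
  have [i xE] := off _ xC; have [f' _ f'K] := bijf; rewrite xE -(f'K y) in xy *.
  rewrite (kE (inl (inr i)) (inl (f' y))).
  apply/esym/(kV i (inl (f' y))).
  by rewrite sup_nb_inr fE.
- move=> s [ns agree].
  have supp_s : supported (superposition petersen u) T s by case: ns => -[].
  have [/(_ agree){}agree _] := agree_on_M_int petersen_sym oldT supp_s supp_sigma.
  apply: (supported_inj symS supp_ext supp_s) => x xT y xy.
  have nks := normal_on_transport bijF FE (can_inj r'K) (hue_normal symS ns).
  rewrite FT in nks; rewrite hue_ext //.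
  have kV' : forall i y, y \in sup_nb (inl (inr i)) ->
      r' (hue s (F (inl (inr i))) (F y)) = ext_color (inl (inr i)) y.
    move=> i z iz; have := kV i z iz; move: iz; case: z => [z|//] iz hE.
    rewrite /F agree ?hE ?rK //; last first.
      by rewrite -fE -sup_nb_inr.
    by apply/imsetP=> -[j _]; rewrite -fu => /injf.
  have gT : in_ext (g x).
    by have : g x \in [set x | in_ext x]; [rewrite -FT inE gK | rewrite inE].
  have := extension_forced nks kV' gT (y := g y).
  by rewrite -sup_nbE FE !gK /k => <- //; rewrite r'K.
case=> s [_ [t [nt text _]]].
(* Undoing the renaming, a compatible coloring would be a normal coloring that
   extends the model coloring to three consecutive superedges. *)
rewrite /M_ext /M_123 munion_induced // in nt.
set T' := _ :|: _ in nt.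
have supp_t : supported (superposition petersen u) T' t by case: nt => -[].
have := normal_on_transport bijF FE (can_inj r'K) (hue_normal symS nt).
move=> /no_three_superedges -/(_ (inZp 1)); apply.
- by move=> p; rewrite inE in_setU !in_setU mem_superedge ?orbT.
- move=> p; rewrite (_ : ordS _ = inZp 2); last exact/val_inj.
  by rewrite inE !in_setU mem_superedge ?orbT.
- move=> p; rewrite (_ : ordS _ = inZp 3); last exact/val_inj.
  by rewrite inE !in_setU mem_superedge ?orbT.
move=> j y jy.
have jT : inr (j, La) \in T by rewrite !inE imset_f ?orbT.
have jy' : superposition petersen u (inr (j, La)) (F y).
  by rewrite -(FE (inr (j, La))) sup_nbE.
rewrite -(restrict_hue supp_t (subsetUl _ _) jT jy') text hue_ext //.
by rewrite (kE (inr (j, La)) y) rK.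
Qed.
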